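(* Let $G$ be a finite connected loopless undirected multigraph and let $\mathcal{O}$ be a partial orientation of $G$ with $\deg(D_{\mathcal{O}})=k$. Let $\mathcal{G}_k$ be the graph whose vertices are the classes $[\mathcal{O}_0]$ of partial orientations $\mathcal{O}_0$ of $G$ with $\deg(D_{\mathcal{O}_0})=k$, modulo equivalence in the generalized cycle--cocycle reversal system, in which $[\mathcal{O}_0]$ and $[\mathcal{O}_0']$ are adjacent if there exist $\mathcal{O}_1\in[\mathcal{O}_0]$ and $\mathcal{O}_2\in[\mathcal{O}_0']$ such that $\mathcal{O}_2$ is obtained from $\mathcal{O}_1$ by reversing some directed path. Let $A$ be the set of vertices of $\mathcal{G}_k$ whose class contains an acyclic partial orientation, and let $d([\mathcal{O}],A)$ be the distance from $[\mathcal{O}]$ to $A$ in $\mathcal{G}_k$. Then $$r(D_{\mathcal{O}})=d([\mathcal{O}],A)-1.$$ That is, the Baker--Norine rank of a divisor associated to a partial orientation is one less than the minimum number of directed paths which need to be reversed in the generalized cycle--cocycle reversal system to produce an acyclic partial orientation.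
   Context: A divisor on $G$ is a function $D:V(G)\to\mathbb{Z}$; $\deg(D)=\sum_v D(v)$; $D$ is effective if $D\ge0$ pointwise. Two divisors are linearly equivalent if their difference lies in the $\mathbb{Z}$-span of the columns of the Laplacian matrix of $G$. The (Baker--Norine) rank $r(D)$ is $\min\deg(E)-1$ over all effective $E$ such that $D-E$ is not linearly equivalent to any effective divisor. A partial orientation $\mathcal{O}$ of $G$ is a choice of direction for each edge in some subset of $E(G)$; the remaining edges are unoriented. Its associated divisor is $D_{\mathcal{O}}(v)=\mathrm{indeg}_{\mathcal{O}}(v)-1$, where $\mathrm{indeg}_{\mathcal{O}}(v)$ is the number of edges oriented towards $v$. $\mathcal{O}$ is acyclic if it contains no directed cycle. A directed path is a path all of whose edges are oriented, the head of each edge being the tail of its successor; reversing it means reversing the direction of each of its edges. Moves on partial orientations: - Edge pivot at $v$: an edge oriented towards $v$ becomes unoriented and an unoriented edge incident to $v$ becomes oriented towards $v$. - Cocycle (cut) reversal: if for some nonempty proper $X\subset V(G)$ every edge of the cut $(X,X^c)$ is oriented and all are oriented in the same direction across the cut, reverse all edges of the cut. - Cycle reversal: reverse all edges of a directed cycle. Two partial orientations are equivalent in the generalized cycle--cocycle reversal system if they are related by a finite sequence of these three moves; $[\mathcal{O}]$ denotes the equivalence class of $\mathcal{O}$. *)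

(* Defs.v *)
From HB Require Import structures.
From mathcomp Require Import all_boot all_order all_algebra.
From mathcomp Require Import boolp.

Set Implicit Arguments.
Unset Strict Implicit.
Unset Printing Implicit Defensive.

Import Order.TTheory GRing.Theory Num.Theory.
Local Open Scope ring_scope.

(* Parallel edges are distinct elements of [edge] with the same ends; an edge
   has two distinct ends, so there are no loops. *)
Record multigraph := Multigraph {
  vertex : finType;
  edge : finType;
  ends : edge -> {set vertex};
  card_ends : forall e, #|ends e| = 2%N
}.

Definition is_least {disp} {T : porderType disp} (P : T -> Prop) (m : T) :=
  P m /\ forall n, P n -> (m <= n)%O.

Section Multigraph.
Variable G : multigraph.
Local Notation V := (vertex G).
Local Notation E := (edge G).

Definition adjacent : rel V :=
  [rel u v | [exists e : E, ends e == [set u; v]]].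

Definition connected : Prop :=
  (0 < #|V|)%N /\ forall u v : V, connect adjacent u v.

Definition divisor := {ffun V -> int}.
Implicit Types D F : divisor.

Definition deg D : int := \sum_v D v.

Definition effective D : Prop := forall v, 0 <= D v.

Definition laplacian (u v : V) : int :=
  if u == v then (#|[set e : E | u \in ends e]|)%:Z
  else - (#|[set e : E | ends e == [set u; v]]|)%:Z.

Definition lin_equiv D F : Prop :=
  exists f : {ffun V -> int},
    forall u, D u - F u = \sum_v f v * laplacian u v.

Definition is_rank D (r : int) : Prop :=
  is_least (fun n => exists F : divisor,
    [/\ effective F,
        ~ (exists2 H : divisor, effective H & lin_equiv (D - F) H)
      & n = deg F - 1]) r.

(* [towards e] is [Some v] if [e] is oriented towards its end [v], and [None]
   if [e] is unoriented. *)
Record orientation := Orientation {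
  towards :> {ffun E -> option V};
  _ : [forall e, oapp (fun v => v \in ends e) true (towards e)]
}.

HB.instance Definition _ := [isSub for towards].
HB.instance Definition _ := [Finite of orientation by <:].

Implicit Types O : orientation.

Definition oriented O (e : E) : bool := O e != None.

Definition origin O (e : E) : option V :=
  if O e is Some v then [pick u in ends e | u != v] else None.

Definition divisor_of O : divisor :=
  [ffun v => (#|[set e | O e == Some v]|)%:Z - 1].

Fact reverse_subproof O (S : {set E}) :
  [forall e, oapp (fun v => v \in ends e) true
    ([ffun e => if e \in S then origin O e else O e] e)].
Proof.
apply/forallP=> e; rewrite ffunE; case: ifP => _; last first.
  by case: O => t /= /forallP.
rewrite /origin; case: (O e) => [v|] //.
by case: pickP => //= u /andP[].
Qed.

Definition reverse O (S : {set E}) : orientation :=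
  Orientation (reverse_subproof O S).

(* [sorted] and [cycle] relate consecutive edges only. *)
Definition follows O : rel E := [rel e f | O e == origin O f].

Definition directed_path O (p : seq E) : bool :=
  if p is e :: _ then
    [&& all (oriented O) p, sorted (follows O) p
      & uniq (origin O e :: [seq O f | f <- p])]
  else false.

Definition directed_cycle O (c : seq E) : bool :=
  [&& c != [::], all (oriented O) c, cycle (follows O) c
    & uniq [seq O e | e <- c]].

Definition acyclic O : Prop := forall c, ~~ directed_cycle O c.

Definition cut (X : {set V}) : {set E} := [set e | #|ends e :&: X| == 1%N].

Definition edge_pivot O O' : Prop :=
  exists (v : V) (e f : E),
    [/\ O e = Some v, O f = None & v \in ends f] /\
    [/\ O' e = None, O' f = Some v
      & forall g, g != e -> g != f -> O' g = O g].

(* A cut all of whose edges point out of [X] is covered by the complement of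
   [X], which has the same cut. *)
Definition cut_reversal O O' : Prop :=
  exists X : {set V},
    [/\ X != set0, X != [set: V],
        forall e, e \in cut X -> exists2 v, O e = Some v & v \in X
      & O' = reverse O (cut X)].

Definition cycle_reversal O O' : Prop :=
  exists2 c, directed_cycle O c & O' = reverse O [set e in c].

Definition path_reversal O O' : Prop :=
  exists2 p, directed_path O p & O' = reverse O [set e in p].

Definition move : rel orientation :=
  [rel O O' | `[< [\/ edge_pivot O O', cut_reversal O O'
                    | cycle_reversal O O'] >]].

Definition class_of O : {set orientation} := [set O' | connect move O O'].

Implicit Types C : {set orientation}.

Definition class_vertices (k : int) : {set {set orientation}} :=
  [set class_of O | O in [pred O | deg (divisor_of O) == k]].

Definition class_adjacent (k : int) : rel {set orientation} :=
  [rel C C' | [&& C \in class_vertices k, C' \in class_vertices k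
    & `[< exists O1 O2, [/\ O1 \in C, O2 \in C' & path_reversal O1 O2] >]]].

Definition acyclic_classes (k : int) : {set {set orientation}} :=
  [set C in class_vertices k | `[< exists2 O, O \in C & acyclic O >]].

End Multigraph.

(* There is such a [d] only if some element of [A] is reachable from [x]. *)
Definition is_distance (T : finType) (adj : rel T) (x : T) (A : {set T})
    (d : nat) : Prop :=
  is_least (fun n => exists s : seq T,
    [/\ path adj x s, last x s \in A & size s = n]) d.

(* Main.v *)
Require Import Defs.
From mathcomp Require Import all_boot all_order all_algebra.
From mathcomp Require Import boolp zify ring.

Import Order.TTheory GRing.Theory Num.Theory.
Local Open Scope ring_scope.

Set Implicit Arguments.
Unset Strict Implicit.
Unset Printing Implicit Defensive.

(** Call a divisor winnable if it is equivalent to an effective one. The three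
    moves preserve the linear equivalence class of [D_O], and reversing a
    directed path from [u] to [v] adds the chip [u] and removes the chip [v].
    The divisor of an acyclic partial orientation is never winnable, so undoing
    [d] path reversals that lead to an acyclic class exhibits an effective [F]
    of degree [d] (the sum of the endpoints [v]) with [D_O - F] unwinnable.

    Conversely, let [D_O - F] be unwinnable with [F] effective of degree [n].
    Dhar's algorithm bounds an equivalent divisor by that of an acyclic full
    orientation, and since [D_O - F] has degree less than [|E| - |V|], some
    [D_O - F + u] is still unwinnable. If [D_O] is unwinnable, then unfurling
    (an analogue of Dhar's algorithm by pivots and cut reversals) makes [O]
    acyclic. Otherwise it makes [O] sourceless; then, for any [v] in the support
    of [F], further pivots and cut reversals create a directed path from [u] to
    [v], and reversing it replaces [(D_O, F)] by a pair in which [F] has degree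
    [n - 1]. Hence [n] reversals suffice. *)

(** * Extremal choices and burning orders *)

Section Preliminaries.

(** Induction on the gap [M - f x]; the type may be infinite, as for divisors. *)
Lemma exists_max (T : Type) (P : T -> Prop) (f : T -> int) (M : int) x0 :
    P x0 -> (forall x, P x -> f x <= M) ->
  exists2 x, P x & forall y, P y -> f y <= f x.
Proof.
move=> Px0 leM; have [n] := ubnP `|M - f x0|%N.
elim: n x0 Px0 => // n IHn x Px ltn.
have [max_x|] := pselect (forall y, P y -> f y <= f x); first by exists x.
case/existsNP=> y /not_implyP[Py /negP]; rewrite -ltNge => ltxy.
by apply: (IHn y Py); move: (leM _ Px) (leM _ Py) => *; lia.
Qed.

Lemma exists_max_fin (T : finType) (P : T -> Prop) (f : T -> int) x0 :
  P x0 -> exists2 x, P x & forall y, P y -> f y <= f x.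
Proof.
move=> Px0; apply: (@exists_max _ P f (\sum_x `|f x|) x0 Px0) => x _.
by rewrite (bigD1 x) //= (le_trans (ler_norm _)) // lerDl sumr_ge0.
Qed.

(* Burning process: vertices are added one at a time to the burnt set, and [h]
   records the time at which they burn. *)
Lemma exists_order (V : finType) (B : {set V} -> V -> Prop) :
    (forall X, X != setT -> exists2 v, v \notin X & B X v) ->
  exists2 h : V -> nat, injective h & forall v, B [set u | (h u < h v)%N] v.
Proof.
move=> ext.
(* Generalized to an initial burnt set [X], on which [h] is 0, for induction on the size of its
   complement. *)
have key (X : {set V}) : exists h : V -> nat,
    [/\ forall u, (u \in X) = (h u == 0)%N,
        {in ~: X &, injective h} &
        forall v, v \notin X -> B [set u | (h u < h v)%N] v].
{ have [n] := ubnP #|~: X|; elim: n X => // n IHn X ltn.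
have [->|XT] := eqVneq X setT.
  exists (fun=> 0%N); split=> [u|u v|v]; rewrite ?inE //.
have [v vX BXv] := ext X XT.
have [|h [h0 hI hB]] := IHn (v |: X).
  rewrite setCU setIC -setDE; move: ltn.
  by rewrite (cardsD1 v (~: X)) inE vX ltnS.
have hv0 : h v = 0%N by apply/eqP; rewrite -h0 setU11.
(* Since [v] lies in the enlarged burnt set, [h v = 0]; the shift gives it time 1 and delays all
   later times by one. *)
pose h' u := if u \in X then 0%N else (h u).+1.
exists h'; rewrite /h'; split=> [u|u1 u2|u uX]; first by case: ifP.
  rewrite !inE => /negPf u1X /negPf u2X; rewrite u1X u2X => -[eqh].
  have [u1v|u1v] := eqVneq u1 v.
    by have /eqP := esym eqh; rewrite u1v hv0 -h0 !inE u2X orbF => /eqP.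
  apply: hI => //; rewrite !inE ?negb_or ?u1X ?u1v //.
  rewrite u2X andbT; apply: contraNneq u1v => u2v.
  by move: (h0 u1); rewrite eqh u2v hv0 !inE u1X orbF => /idP.
rewrite (negPf uX); have [->|uv] := eqVneq u v.
  rewrite hv0; suff -> :
    [set u0 | ((if u0 \in X then 0 else (h u0).+1) < 1)%N] = X by [].
  by apply/setP=> x; rewrite inE; case: ifP.
have uvX : u \notin v |: X by rewrite !inE negb_or uv.
have := hB u uvX; congr B; apply/setP=> x; rewrite !inE; case: ifP => // xX.
have := h0 x; rewrite !inE xX orbT => /esym/eqP ->.
by rewrite lt0n -h0 uvX.
}
have [h [h0 hI hB]] := key set0.
exists h => [u v|v]; first by apply: hI; rewrite inE in_set0.
by apply: hB; rewrite in_set0.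
Qed.

Lemma card_sum_mem (T : finType) (A : {pred T}) :
  (#|A|)%:Z = \sum_x (x \in A)%:R.
Proof.
rewrite -natz -sum1_card natr_sum /= big_mkcond /=.
by apply: eq_bigr => x _; case: (x \in A).
Qed.

End Preliminaries.

(** * Laplacian, linear equivalence and winnability *)

Section LinearEquivalence.
Variable G : multigraph.
Local Notation V := (vertex G).
Local Notation E := (edge G).
Implicit Types (D F H : divisor G) (e : E) (u v : V).

Lemma ends_ex e :
  exists uv : V * V, (uv.1 != uv.2) && (ends e == [set uv.1; uv.2]).
Proof.
have /eqP/cards2P[u [v [uv ->]]] := card_ends e.
by exists (u, v); rewrite /= uv eqxx.
Qed.

Definition end1 e := (xchoose (ends_ex e)).1.
Definition end2 e := (xchoose (ends_ex e)).2.

Lemma end12 e : end1 e != end2 e.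
Proof. by have /andP[] := xchooseP (ends_ex e). Qed.

Lemma endsE e : ends e = [set end1 e; end2 e].
Proof. by have /andP[_ /eqP] := xchooseP (ends_ex e). Qed.

Lemma other_end {e v} : v \in ends e ->
  exists2 u, u != v & ends e = [set v; u].
Proof.
rewrite endsE !inE => /orP[]/eqP->; first by exists (end2 e);
  rewrite // eq_sym end12.
by exists (end1 e); rewrite ?end12 1?setUC.
Qed.

Lemma ends_eq2 {e a b} : a != b -> a \in ends e -> b \in ends e ->
  ends e = [set a; b].
Proof.
move=> ab /other_end[u _ ->]; rewrite !inE => /orP[] /eqP ba;
  last by rewrite ba.
by rewrite ba eqxx in ab.
Qed.

(* The (signed) incidence matrix; the Laplacian is its product with its
   transpose. *)
Definition inc v e : int := (v == end1 e)%:R - (v == end2 e)%:R.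

Lemma laplacian_inc u v : laplacian u v = \sum_e inc u e * inc v e.
Proof.
rewrite /laplacian; case: eqVneq => [<-|uv].
  rewrite card_sum_mem; apply: eq_bigr => e _.
  have := end12 e; rewrite inE endsE !inE /inc.
  have [->|_] := eqVneq u (end1 e) => e12; first by rewrite (negPf e12).
  by have [] := eqVneq u (end2 e).
rewrite card_sum_mem -sumrN; apply: eq_bigr => e _.
rewrite inE /inc; have ends12 := end12 e.
have -> : (ends e == [set u; v]) = (u \in ends e) && (v \in ends e).
  apply/eqP/andP=> [->|[ue ve]]; first by rewrite !inE !eqxx orbT.
  exact: ends_eq2.
rewrite endsE !inE.
case: (eqVneq u (end1 e)) uv ends12 => [<-|_];
  case: (eqVneq u (end2 e)) => [<-|_];
  rewrite ?eqxx //= => uv ends12; rewrite ?[v == u]eq_sym ?(negPf uv) //=;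
  case: eqVneq => //= _; case: eqVneq => //=.
Qed.

Definition laplace (f : {ffun V -> int}) : divisor G :=
  [ffun u => \sum_v f v * laplacian u v].

Lemma sum_inc (f : V -> int) e : \sum_v f v * inc v e = f (end1 e) - f (end2 e).
Proof.
rewrite /inc; under eq_bigr do rewrite mulrBr.
rewrite sumrB (bigD1 (end1 e)) //= [X in _ - X](bigD1 (end2 e)) //= !eqxx
  !mulr1.
by rewrite !big1 ?addr0 // => i /negPf ->; rewrite mulr0.
Qed.

Lemma laplaceE f u : laplace f u = \sum_e inc u e * (f (end1 e) - f (end2 e)).
Proof.
rewrite ffunE; under eq_bigr do rewrite laplacian_inc mulr_sumr.
rewrite exchange_big /=; apply: eq_bigr => e _.
by rewrite -sum_inc mulr_sumr; apply: eq_bigr => v _; ring.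
Qed.

(** Discrete Green identity, or summation by parts over the edges. *)
Lemma laplace_dot (w : V -> int) f :
  \sum_u w u * laplace f u =
  \sum_e (w (end1 e) - w (end2 e)) * (f (end1 e) - f (end2 e)).
Proof.
under eq_bigr do rewrite laplaceE mulr_sumr.
rewrite exchange_big /=; apply: eq_bigr => e _.
by rewrite -[in RHS]sum_inc mulr_suml; apply: eq_bigr => v _; ring.
Qed.

Lemma deg_laplace f : deg (laplace f) = 0.
Proof.
rewrite /deg; under eq_bigr do rewrite -[laplace f _]mul1r.
by rewrite (laplace_dot (fun=> 1)) big1 // => e _; rewrite subrr mul0r.
Qed.

Lemma inc_notin e u : u \notin ends e -> inc u e = 0.
Proof. by rewrite endsE !inE negb_or /inc => /andP[/negPf-> /negPf->]. Qed.

Lemma end12_cases e u v : u != v -> ends e = [set u; v] ->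
  (end1 e = u /\ end2 e = v) \/ (end1 e = v /\ end2 e = u).
Proof.
move=> uv eqe; have := end12 e.
have: (end1 e \in ends e) && (end2 e \in ends e).
  by rewrite endsE !inE !eqxx orbT.
rewrite eqe !inE => /andP[].
by case/orP=> /eqP-> /orP[]/eqP->; rewrite ?eqxx //; [left|right].
Qed.

(** Exchanging [end1] and [end2] changes the sign of both factors. *)
Lemma inc_diff (f : V -> int) e u v : u != v -> ends e = [set u; v] ->
  inc u e * (f (end1 e) - f (end2 e)) = f u - f v.
Proof.
move=> uv /(end12_cases uv) [] [e1 e2]; rewrite /inc e1 e2 eqxx.
  by rewrite (negPf uv) /=; ring.
by rewrite (negPf uv) /=; ring.
Qed.

Lemma laplaceD f g : laplace (f + g) = laplace f + laplace g.
Proof.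
apply/ffunP=> u; rewrite [RHS]ffunE !laplaceE -big_split /=.
by apply: eq_bigr => e _; rewrite !ffunE; ring.
Qed.

Lemma laplaceN f : laplace (- f) = - laplace f.
Proof.
apply/ffunP=> u; rewrite [RHS]ffunE !laplaceE -sumrN /=.
by apply: eq_bigr => e _; rewrite !ffunE; ring.
Qed.

Lemma lin_equivP D F : lin_equiv D F <-> exists f, D = F + laplace f.
Proof.
split=> [[f eqf]|[f ->]]; exists f; last by move=> u; rewrite !ffunE; ring.
by apply/ffunP=> u; rewrite !ffunE -eqf; ring.
Qed.

Lemma lin_equiv_laplace D f : lin_equiv (D + laplace f) D.
Proof. by apply/lin_equivP; exists f. Qed.

Lemma lin_equiv_refl D : lin_equiv D D.
Proof.
exists 0 => u; rewrite subrr big1 // => v _; by rewrite ffunE mul0r.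
Qed.

Lemma lin_equiv_sym D F : lin_equiv D F -> lin_equiv F D.
Proof.
by move=> /lin_equivP[f ->]; apply/lin_equivP; exists (- f);
  rewrite laplaceN addrK.
Qed.

Lemma lin_equiv_trans F D H : lin_equiv D F -> lin_equiv F H -> lin_equiv D H.
Proof.
move=> /lin_equivP[f ->] /lin_equivP[g ->]; apply/lin_equivP; exists (g + f).
by rewrite laplaceD addrA.
Qed.

Lemma lin_equivD2r H D F : lin_equiv D F -> lin_equiv (D + H) (F + H).
Proof.
by move=> /lin_equivP[f ->]; apply/lin_equivP; exists f; rewrite addrAC.
Qed.

Lemma degD D F : deg (D + F) = deg D + deg F.
Proof. by rewrite /deg -big_split; apply: eq_bigr => v _; rewrite ffunE. Qed.

Lemma degN D : deg (- D) = - deg D.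
Proof. by rewrite /deg -sumrN; apply: eq_bigr => v _; rewrite ffunE. Qed.

Lemma lin_equiv_deg D F : lin_equiv D F -> deg D = deg F.
Proof. by move=> /lin_equivP[f ->]; rewrite degD deg_laplace addr0. Qed.

Definition chip u : divisor G := [ffun v => (v == u)%:R].

Lemma deg_chip u : deg (chip u) = 1.
Proof.
rewrite /deg (bigD1 u) //= ffunE eqxx big1 ?addr0 // => v /negPf uv.
by rewrite ffunE uv.
Qed.

Definition winnable D : Prop := exists2 H, effective H & lin_equiv D H.

Lemma winnable_equiv D F : lin_equiv D F -> winnable F -> winnable D.
Proof. by move=> DF [H H0 FH]; exists H => //; apply: lin_equiv_trans FH. Qed.

Lemma effectiveD D F : effective D -> effective F -> effective (D + F).
Proof. by move=> D0 F0 v; rewrite ffunE addr_ge0 ?D0 ?F0. Qed.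

Lemma effective_chip u : effective (chip u).
Proof. by move=> v; rewrite ffunE ler0n. Qed.

Lemma winnableD D F : winnable D -> effective F -> winnable (D + F).
Proof.
move=> [H H0 DH] F0; exists (H + F); first exact: effectiveD.
exact: lin_equivD2r.
Qed.

Lemma winnable_deg D : winnable D -> 0 <= deg D.
Proof.
by move=> [H H0 /lin_equiv_deg ->]; apply: sumr_ge0 => v _; apply: H0.
Qed.

End LinearEquivalence.

(** * Set firing and weights decreasing away from a base vertex *)

Section Firing.
Variables (G : multigraph) (connG : connected G).
Local Notation V := (vertex G).
Local Notation E := (edge G).

(** Without such an edge [X] would be closed under adjacency, against connectivity. *)
Lemma crossing_edge (X : {set V}) : X != set0 -> X != setT ->
  exists e x y, [/\ ends e = [set x; y], x \in X & y \notin X].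
Proof.
move=> /set0Pn[x0 x0X]; rewrite -subTset => /subsetPn[y0 _ y0X].
apply: contrapT => nocross; have [_ /(_ x0 y0) x0y0] := connG.
suff cl : closed (@adjacent G) (mem X).
  by have := closed_connect cl x0y0; rewrite /= x0X (negPf y0X).
move=> x y /existsP[e /eqP exy]; apply/idP/idP => [xX|yX];
  apply: contrapT => /negP.
  by move=> yX; apply: nocross; exists e, x, y.
by move=> xX; apply: nocross; exists e, y, x; rewrite setUC.
Qed.

Definition indicator (Y : {set V}) : {ffun V -> int} :=
  [ffun v => (v \in Y)%:R].

(* Weights decreasing so fast away from [q] that firing any set that avoids [q]
   (which moves some chip towards [q]) increases the weight of the divisor. *)
Lemma exists_firing_weight (q : V) : exists2 w : V -> int, forall v, 0 < w v &
  forall Y : {set V}, Y != set0 -> q \notin Y ->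
    \sum_u w u * laplace (indicator Y) u < 0.
Proof.
(* With this ratio one edge towards [q] outweighs all [#|E|] edges. *)
pose M : int := (#|E|.+1)%:Z.
have [w w0 wq] : exists2 w : V -> int, forall v, 0 < w v & forall v, v != q ->
    exists u e, [/\ u != v, ends e = [set v; u] & M * w v <= w u].
  (* A burning order from [q] gives every other vertex an earlier neighbour; the weight is a power
     of [M] that falls with the burning time. *)
  have [X|h hI hB] := @exists_order V (fun X v => if X == set0 then v = q
      else exists u e, u \in X /\ ends e = [set v; u]).
    have [->|X0] := eqVneq X set0 => XT; first by exists q; rewrite ?inE.
    have [e [x [y [exy xX yX]]]] := crossing_edge X0 XT.
    by exists y => //; exists x, e; rewrite setUC.
  pose N := \max_v h v.
  have hN v : (h v <= N)%N by apply: leq_bigmax.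
  exists (fun v => M ^+ (N - h v)) => [v|v vq]; first by rewrite exprn_gt0.
  have := hB v; case: eqP => [_ /eqP|_ [u [e [uX euv]]]];
    first by rewrite (negPf vq).
  rewrite inE in uX; exists u, e; split=> //.
    by apply: contraTneq uX => ->; rewrite ltnn.
  rewrite -exprS ler_weXn2l //.
  by have := hN v; lia.
exists w => // Y /set0Pn[y0 y0Y] qY; rewrite laplace_dot.
(* The heavier neighbour [x] of a heaviest vertex [y] of [Y] lies outside [Y]. *)
have [y yY ymax] := @exists_max_fin V (fun y => y \in Y) w y0 y0Y.
have [x [e0 [xy eyx wx]]] : exists u e,
    [/\ u != y, ends e = [set y; u] & M * w y <= w u].
  by apply: wq; apply: contraNneq qY => <-.
have wy := w0 y.
have xY : x \notin Y.
  apply/negP=> /ymax; apply/negP; rewrite -ltNge; apply: lt_le_trans wx.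
  have : (0 < #|E|)%N by apply/card_gt0P; exists e0.
  by rewrite /M; nia.
(* The edge [e0] from [y] to [x] contributes at most [w y - M * w y], every other edge at most
   [w y]. *)
apply: (@le_lt_trans _ _ (\sum_(e : E) (w y - (e == e0)%:R * (M * w y))));
  last first.
  rewrite sumrB sumr_const (bigD1 e0) //= eqxx big1 => [|e /negPf->];
    last by rewrite mul0r.
  by rewrite -mulr_natr natz /M /=; have -> : #|xpredT : pred E| = #|E| by [];
    nia.
apply: ler_sum => e _; have [->|ee0] := eqVneq e e0.
  have yx : y != x by rewrite eq_sym.
  have [[-> ->]|[-> ->]] := end12_cases yx eyx;
    rewrite !ffunE yY (negPf xY) /=; lia.
have := ymax (end1 e); have := ymax (end2 e); have := w0 (end1 e);
  have := w0 (end2 e).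
rewrite !ffunE mul0r; case: (end1 e \in Y);
  case: (end2 e \in Y) => /= p1 p2 m1 m2;
  try have {}m1 := m1 isT; try have {}m2 := m2 isT; lia.
Qed.

End Firing.

(** * Divisors of partial orientations and the effect of reversals *)

Section Orientations.
Variable G : multigraph.
Local Notation V := (vertex G).
Local Notation E := (edge G).
Implicit Types (O : orientation G) (e f : E) (u v : V).

Lemma towards_ends O e v : O e = Some v -> v \in ends e.
Proof. by case: O => t /= /forallP /(_ e) + eqt; rewrite eqt. Qed.

Lemma originP O e v : O e = Some v ->
  exists u, [/\ u != v, ends e = [set v; u] & origin O e = Some u].
Proof.
move=> Oe; have [u uv eqe] := other_end (towards_ends Oe).
exists u; split=> //; rewrite /origin Oe; case: pickP => [x|/(_ u)].
  by rewrite eqe !inE => /andP[/orP[]/eqP->]; rewrite ?eqxx.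
by rewrite eqe !inE eqxx orbT uv.
Qed.

Lemma origin_ends O e u v : O e = Some v -> origin O e = Some u ->
  u != v /\ ends e = [set v; u].
Proof. by move=> /originP[x [xv eqe ->]] [<-]. Qed.

Lemma divisor_ofE O v : divisor_of O v = \sum_e (O e == Some v)%:R - 1.
Proof.
by rewrite ffunE card_sum_mem; congr (_ - _); apply: eq_bigr => e _;
  rewrite inE.
Qed.

Lemma divisor_of_ge0 O v : (0 <= divisor_of O v) = [exists e, O e == Some v].
Proof.
rewrite ffunE subr_ge0 lez_nat card_gt0; apply/set0Pn/existsP => -[e].
  by rewrite inE; exists e.
by exists e; rewrite inE.
Qed.

Lemma effective_divisor_of O :
  effective (divisor_of O) <-> forall v, exists e, O e = Some v.
Proof.
split=> [eff v|src v]; last by rewrite divisor_of_ge0; apply/existsP;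
  have [e /eqP] := src v; exists e.
by have := eff v; rewrite divisor_of_ge0 => /existsP[e /eqP]; exists e.
Qed.

Lemma deg_divisor_of O :
  deg (divisor_of O) = (#|[set e | oriented O e]|)%:Z - (#|V|)%:Z.
Proof.
rewrite /deg; under eq_bigr do rewrite divisor_ofE.
rewrite sumrB sumr_const exchange_big /= card_sum_mem; congr (_ - _);
  last first.
  by rewrite natz.
apply: eq_bigr => e _; rewrite inE /oriented; case: (O e) => [u|] /=;
  last by rewrite big1.
rewrite (bigD1 u) //= eqxx big1 ?addr0 // => v vu.
by rewrite (inj_eq Some_inj) eq_sym (negPf vu).
Qed.

Lemma deg_divisor_of_le O : deg (divisor_of O) <= (#|E|)%:Z - (#|V|)%:Z.
Proof. by rewrite deg_divisor_of lerD2r lez_nat max_card. Qed.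

Lemma divisor_of_reverse O (S : {set E}) v :
  divisor_of (reverse O S) v =
  divisor_of O v +
    \sum_(e in S) ((origin O e == Some v)%:R - (O e == Some v)%:R).
Proof.
rewrite !divisor_ofE [X in _ = _ + X]big_mkcond /= addrAC -big_split /=;
  congr (_ - _).
by apply: eq_bigr => e _; rewrite ffunE; case: ifP => _;
  rewrite ?addr0 // subrKC.
Qed.

Lemma cut_cross (X : {set V}) e u v : u != v -> ends e = [set u; v] ->
  (e \in cut X) = (u \in X) (+) (v \in X).
Proof.
move=> uv eqe; rewrite inE eqe setIUl cardsU.
have -> : [set u] :&: X :&: ([set v] :&: X) = set0.
  apply/setP=> z; rewrite !inE; apply/negP => /andP[/andP[/eqP-> _] /andP[]].
  by rewrite (negPf uv).
have c1 x : #|[set x] :&: X| = (x \in X).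
  case: (boolP (x \in X)) => xX; last first.
    by apply: eq_card0 => z; rewrite !inE; apply/negP=> /andP[/eqP-> /idPn[]].
  by rewrite -[RHS](cards1 x); apply: eq_card => z; rewrite !inE;
    case: eqP => // ->.
by rewrite !c1 cards0 subn0; case: (u \in X); case: (v \in X).
Qed.

(** Each reversed edge moves one chip from its end in [X] to its other end, so the reversal fires
    [X]. *)
Lemma divisor_of_cut O (X : {set V}) :
    (forall e, e \in cut X -> exists2 v, O e = Some v & v \in X) ->
  divisor_of (reverse O (cut X)) = divisor_of O - laplace (indicator X).
Proof.
move=> outX; apply/ffunP=> v; rewrite divisor_of_reverse [RHS]ffunE;
  congr (_ + _).
rewrite [RHS]ffunE laplaceE -sumrN big_mkcond /=; apply: eq_bigr => e _.
case: ifPn => [/[dup]/outX [x Oe xX]|].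
  have [y [yx eqe ->]] := originP Oe; rewrite Oe.
  rewrite eq_sym in yx; rewrite (cut_cross _ yx eqe) xX /= => /negPf yX.
  rewrite !(inj_eq Some_inj) ![_ == v]eq_sym !ffunE /inc.
  by have [[-> ->]|[-> ->]] := end12_cases yx eqe; rewrite xX yX /=; ring.
have /andP[] : (end1 e != end2 e) && (ends e == [set end1 e; end2 e]).
  by rewrite end12 -endsE /=.
move=> e12 /eqP eqe; rewrite (cut_cross _ e12 eqe) !ffunE => /negPf.
by case: (end1 e \in X); case: (end2 e \in X) => //= _; ring.
Qed.

(** The sum telescopes, each head being the origin of the next edge. *)
Lemma sum_walk (a : option V -> int) O e p : path (follows O) e p ->
  \sum_(f <- e :: p) (a (origin O f) - a (O f)) =
  a (origin O e) - a (O (last e p)).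
Proof.
elim: p e => [|f p IHp] e /=; first by rewrite big_seq1.
by case/andP=> /eqP eqf /IHp IH; rewrite big_cons IH -eqf; ring.
Qed.
End Orientations.

(** * Invariance under moves, directed walks, and acyclicity *)

Section Moves.
Variable G : multigraph.
Local Notation V := (vertex G).
Local Notation E := (edge G).
Implicit Types (O : orientation G) (e f : E) (u v : V).

Lemma divisor_of_cycle O c : directed_cycle O c ->
  divisor_of (reverse O [set e in c]) = divisor_of O.
Proof.
case: c => // e c /and4P[_ _ cyc /map_uniq uc].
apply/ffunP=> v; rewrite divisor_of_reverse.
under eq_bigl do rewrite inE.
rewrite -big_uniq //=.
(* The closed walk counts [e] twice; the telescoped total equals the second copy, so the rest sums
   to 0. *)
have /= := sum_walk (fun x => (x == Some v)%:R) cyc.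
rewrite -rcons_cons big_rcons /= last_rcons => /(canRL (addrK _));
  rewrite subrr => ->; exact: addr0.
Qed.

Lemma divisor_of_path O p : directed_path O p ->
  exists u v,
    divisor_of (reverse O [set e in p]) = divisor_of O + chip u - chip v.
Proof.
case: p => // e p /and3P[ori walk up].
have [v Ov] : exists v, O (last e p) = Some v.
  move/allP/(_ _ (mem_last e p)): ori; rewrite /oriented.
  by case: (O _) => // v _; exists v.
have [x Ox] : exists x, O e = Some x.
  by case/andP: ori; rewrite /oriented; case: (O _) => // x _ _; exists x.
have [u [_ _ Ou]] := originP Ox.
exists u, v; apply/ffunP=> z; rewrite divisor_of_reverse.
under eq_bigl do rewrite inE.
rewrite -big_uniq; last first.
  by move: up; rewrite cons_uniq => /andP[_ /map_uniq].
rewrite (sum_walk (fun x => (x == Some z)%:R) walk) Ou Ov !ffunE.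
by rewrite !(inj_eq Some_inj) ![_ == z]eq_sym addrA.
Qed.

Lemma divisor_of_pivot O O' : edge_pivot O O' -> divisor_of O' = divisor_of O.
Proof.
case=> [v [e [f [[Oe Of _] [O'e O'f OO']]]]]; apply/ffunP=> x;
  rewrite !divisor_ofE.
have fe : f != e by apply/eqP=> fe; rewrite fe Oe in Of.
rewrite (bigD1 e) // (bigD1 f) //= [in RHS](bigD1 e) // [in RHS](bigD1 f) //=.
rewrite Oe Of O'e O'f /= add0r; congr (_ + _ - _); rewrite add0r.
by apply: eq_bigr => g /andP[ge gf]; rewrite OO'.
Qed.

Lemma move_lin_equiv O O' :
  move O O' -> lin_equiv (divisor_of O') (divisor_of O).
Proof.
move=> /asboolP[/divisor_of_pivot->|[X [_ _ outX ->]]|[c cyc ->]].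
- exact: lin_equiv_refl.
- by rewrite divisor_of_cut // -laplaceN; apply: lin_equiv_laplace.
- by rewrite divisor_of_cycle //; apply: lin_equiv_refl.
Qed.

Lemma class_lin_equiv O O' : O' \in class_of O ->
  lin_equiv (divisor_of O') (divisor_of O).
Proof.
rewrite inE => /connectP[p pathp ->]; elim: p O pathp => [|O1 p IHp] O /=.
  by move=> _; apply: lin_equiv_refl.
by case/andP=> /move_lin_equiv OO1 /IHp /lin_equiv_trans; apply.
Qed.

Lemma class_of_refl O : O \in class_of O.
Proof. by rewrite inE connect0. Qed.

Lemma class_of_trans O1 O O2 :
  O1 \in class_of O -> O2 \in class_of O1 -> O2 \in class_of O.
Proof. by rewrite !inE; apply: connect_trans. Qed.

Lemma exists_pivot O e f v : O e = Some v -> O f = None -> v \in ends f ->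
  exists O', [/\ O' \in class_of O, divisor_of O' = divisor_of O,
    O' e = None, O' f = Some v & forall g, g != e -> g != f -> O' g = O g].
Proof.
move=> Oe Of vf.
have tP : [forall g, oapp (fun v => v \in ends g) true
    ([ffun g => if g == e then None else if g == f then Some v else O g] g)].
  apply/forallP=> g; rewrite ffunE; case: eqP => // _; case: eqP => [->|_] //.
  by case: (O) => t /= /forallP.
have fe : f != e by apply/eqP=> fe; rewrite fe Oe in Of.
pose O' := Orientation tP; have piv : edge_pivot O O'.
  exists v, e, f; split; split=> //; rewrite /= ?ffunE ?eqxx ?(negPf fe) //.
  by move=> g /negPf ge /negPf gf; rewrite ffunE ge gf.
exists O'; split; rewrite /= ?ffunE ?eqxx ?(negPf fe) //.
- by rewrite inE connect1 //; apply/asboolP; constructor.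
- exact: divisor_of_pivot.
- by move=> g /negPf ge /negPf gf; rewrite ffunE ge gf.
Qed.

Definition arrow O : rel V :=
  [rel u v | [exists e, (origin O e == Some u) && (O e == Some v)]].

Lemma arrowP O u v :
  reflect (exists2 e, origin O e = Some u & O e = Some v) (arrow O u v).
Proof.
apply: (iffP existsP) => -[e]; first by case/andP=> /eqP ? /eqP ?; exists e.
by move=> ? ?; exists e; apply/andP; split; apply/eqP.
Qed.

(** Allowing any edge [e] into [u] lets the walk be extended backwards, both in the induction and
    when a cycle is closed. *)
Lemma walk_edges O u p : path (arrow O) u p -> exists es,
  [/\ [seq O f | f <- es] = map Some p, all (oriented O) es &
      forall e, O e = Some u -> path (follows O) e es].
Proof.
elim: p u => [|x p IHp] u /=; first by exists [::].
case/andP=> /arrowP[f Ouf Of] /IHp[es [heads ori walk]].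
exists (f :: es); split=> [/=|/=|e Oe /=]; first by rewrite Of heads.
  by rewrite /oriented Of.
by rewrite walk // andbT; apply/eqP; rewrite Oe Ouf.
Qed.

Lemma connect_directed_path O u v : u != v -> connect (arrow O) u v ->
  exists p, directed_path O p /\
    divisor_of (reverse O [set e in p]) = divisor_of O + chip u - chip v.
Proof.
move=> uv /connectP[p0 /shortenP[p pathp up _] ev].
case: p pathp up ev => [_ _ /= ev|x p]; first by rewrite ev eqxx in uv.
rewrite /= => /andP[/arrowP[f Ouf Of] /walk_edges[es [heads ori walk]]] up ev.
have dp : directed_path O (f :: es).
  apply/and3P; split; first by rewrite /= ori andbT /oriented Of.
    exact: walk.
  rewrite [map _ _]/= Ouf Of heads.
  by have : uniq [:: u, x & p] := up; rewrite -(map_inj_uniq Some_inj).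
exists (f :: es); split=> //.
apply/ffunP=> z; rewrite divisor_of_reverse.
under eq_bigl do rewrite inE.
rewrite -big_uniq; last first.
  by case/and3P: dp => _ _; rewrite cons_uniq => /andP[_ /map_uniq].
rewrite (sum_walk (fun x =>
  (x == Some z)%:R) (walk _ Of)) Ouf -last_map heads Of last_map -ev.
by rewrite !ffunE !(inj_eq Some_inj) ![_ == z]eq_sym addrA.
Qed.

(** A vertex [v] of [X] with the fewest ancestors has an in-neighbour [w] in [X] with the same
    ancestors. As [v] is one of them, a path from [v] back to [w] closes up. *)
Lemma directed_cycle_ex O (X : {set V}) : X != set0 ->
    (forall v, v \in X -> exists2 u, u \in X & arrow O u v) ->
  exists c, directed_cycle O c.
Proof.
move=> /set0Pn[x0 x0X] inX.
have [v vX vmin] := @exists_max_fin V (fun v => v \in X)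
  (fun v => - (#|[set x | connect (arrow O) x v]|)%:Z) x0 x0X.
have [w wX wv] := inX v vX.
have : [set x | connect (arrow O) x w] == [set x | connect (arrow O) x v].
  rewrite eqEcard; apply/andP; split.
    by apply/subsetP=> x; rewrite !inE => /connect_trans; apply;
      apply: connect1.
  by have := vmin w wX; rewrite lerN2 lez_nat.
move=> /eqP/setP/(_ v); rewrite !inE connect0 => /connectP[p0].
move=> /shortenP[p pathp up _] ew.
have [es [heads ori walk]] := walk_edges pathp.
have /arrowP[e Owe Oe] := wv.
exists (e :: es); apply/and4P; split=> //=.
- by rewrite /oriented Oe.
- rewrite rcons_path walk //; apply/eqP.
  by rewrite -(last_map O) heads Oe last_map Owe -ew.
- by have := up; rewrite -(map_inj_uniq Some_inj) heads Oe.
Qed.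

(* Firing the set where [f] is maximal would take from each of its vertices
   one chip per edge leaving it. *)
Lemma acyclic_unwinnable O :
  (0 < #|V|)%N -> acyclic O -> ~ winnable (divisor_of O).
Proof.
move=> /card_gt0P[v0 _] acO [H H0 /lin_equivP[f eqD]].
have [m _ fmax] := @exists_max_fin V (fun=> True) f v0 I.
suff [c cyc] : exists c, directed_cycle O c by have := acO c; rewrite cyc.
apply: (@directed_cycle_ex O [set v | f v == f m]).
  by apply/set0Pn; exists m; rewrite inE.
move=> v; rewrite inE => /eqP fv; apply: contrapT => noarrow.
(* Each edge into [v] contributes at least 1 to [laplace f v] and no edge contributes a negative
   amount; the [- 1] in the divisor makes this strict. *)
have : divisor_of O v < laplace f v; last first.
  by rewrite ltNge eqD [leRHS]ffunE lerDr H0.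
rewrite divisor_ofE ltrBlDr ltzD1 laplaceE; apply: ler_sum => e _.
have [/[dup]/eqP Oe _|_] := boolP (O e == Some v).
  have [u [uv eqe Ou]] := originP Oe; rewrite (inc_diff _ _ eqe) 1?eq_sym //.
  have := fmax u I; rewrite le_eqVlt => /orP[/eqP fu|]; last by rewrite fv; lia.
  by case: noarrow; exists u; rewrite ?inE ?fu ?eqxx //; apply/arrowP; exists e.
have [ve|/inc_notin ->] := boolP (v \in ends e); last by rewrite mul0r.
have [u uv eqe] := other_end ve; rewrite (inc_diff _ _ eqe) 1?eq_sym //.
by rewrite fv subr_ge0 fmax.
Qed.

(** Along a directed cycle the values of [h] at the heads would increase all the way round. *)
Lemma acyclic_of_rank O (h : V -> nat) :
    (forall e u v, O e = Some v -> origin O e = Some u -> (h u < h v)%N) ->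
  acyclic O.
Proof.
move=> hlt [|e c] //; apply/negP => /and4P[_ ori cyc _].
pose k e := oapp h 0%N (O e).
have : cycle ltn (map k (e :: c)).
  apply: (homo_cycle_in (P := oriented O)) cyc => //.
  move=> x y _; rewrite /in_mem /= /k /oriented => + /eqP Ox; rewrite Ox.
  case Oy : (O y) => [v|] // _; have [u [_ _ Ou]] := originP Oy.
  by rewrite Ou /=; apply: hlt Oy Ou.
rewrite cycle_all2rel; last by move=> ? ? ?; apply: ltn_trans.
by move=> /allrelP/(_ (k e) (k e) (mem_head _ _) (mem_head _ _)) /=;
  rewrite ltnn.
Qed.
End Moves.

(** * Dhar's burning algorithm *)

Section Unspecial.
Variables (G : multigraph) (connG : connected G).
Local Notation V := (vertex G).
Local Notation E := (edge G).
Implicit Types (D F H : divisor G) (u v q : V).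

Lemma effective_le_deg H v : effective H -> H v <= deg H.
Proof. by move=> H0; rewrite /deg (bigD1 v) //= lerDl sumr_ge0. Qed.

Lemma effective_subr_chip H v :
  effective H -> 0 < H v -> effective (H - chip v).
Proof.
move=> H0 Hv u; rewrite !ffunE; case: eqP => [->|_] /=; last by rewrite subr0.
by rewrite subr_ge0 -gtz0_ge1.
Qed.

Lemma laplace_indicator_le0 (Y : {set V}) v :
  v \notin Y -> laplace (indicator Y) v <= 0.
Proof.
move=> /negPf vY; rewrite laplaceE; apply: sumr_le0 => e _.
have [ve|/inc_notin ->] := boolP (v \in ends e); last by rewrite mul0r.
have [u uv eqe] := other_end ve; rewrite (inc_diff _ _ eqe) 1?eq_sym //.
by rewrite !ffunE vY sub0r oppr_le0 ler0n.
Qed.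

(** For [v] outside [X], the second condition puts the other end of [e] in [X]. *)
Definition edges_into (X : {set V}) v : {set E} :=
  [set e | (v \in ends e) && (ends e :&: X != set0)].

Lemma edges_intoP (X : {set V}) u v e :
  v \notin X -> u != v -> ends e = [set v; u] ->
  (e \in edges_into X v) = (u \in X).
Proof.
move=> vX uv eqe; rewrite inE eqe !inE eqxx /=; apply/set0Pn/idP => [[z]|uX].
  by rewrite !inE => /andP[/orP[/eqP->|/eqP->//]]; rewrite (negPf vX).
by exists u; rewrite !inE eqxx orbT.
Qed.

Lemma laplace_indicator (X : {set V}) v : v \notin X ->
  laplace (indicator (~: X)) v = (#|edges_into X v|)%:Z.
Proof.
move=> vX; rewrite laplaceE card_sum_mem; apply: eq_bigr => e _.
have [ve|ve] := boolP (v \in ends e); last first.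
  by rewrite (inc_notin ve) mul0r inE (negPf ve).
have [u uv eqe] := other_end ve; rewrite (inc_diff _ _ eqe) 1?eq_sym //.
by rewrite (edges_intoP vX uv eqe) !ffunE !inE vX; case: (u \in X).
Qed.

Definition order_towards (h : V -> nat) : {ffun E -> option V} :=
  [ffun e => Some (if (h (end1 e) < h (end2 e))%N then end2 e else end1 e)].

Fact order_towards_subproof h :
  [forall e, oapp (fun v => v \in ends e) true (order_towards h e)].
Proof.
by apply/forallP=> e; rewrite ffunE /= endsE !inE; case: ifP;
  rewrite eqxx ?orbT.
Qed.

Definition order_orientation h := Orientation (order_towards_subproof h).

Lemma order_orientationE h e u v :
  injective h -> v != u -> ends e = [set v; u] ->
  (order_orientation h e == Some v) = (h u < h v)%N.
Proof.
move=> hI vu eqe; have hvu : h v != h u by rewrite (inj_eq hI).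
rewrite /order_orientation /= ffunE (inj_eq Some_inj).
have [[-> ->]|[-> ->]] := end12_cases vu eqe; case: ltngtP hvu => //;
  rewrite ?eqxx //.
  by rewrite eq_sym (negPf vu).
by rewrite eq_sym (negPf vu).
Qed.

Lemma order_orientation_acyclic h :
  injective h -> acyclic (order_orientation h).
Proof.
move=> hI; apply: (@acyclic_of_rank _ _ h) => e u v Oe Ou.
have [uv eqe] := origin_ends Oe Ou.
by rewrite -(order_orientationE hI _ eqe) 1?eq_sym // Oe.
Qed.

Lemma order_orientation_divisor h v : injective h ->
  divisor_of (order_orientation h) v =
  (#|edges_into [set u | (h u < h v)%N] v|)%:Z - 1.
Proof.
move=> hI; rewrite divisor_ofE card_sum_mem; congr (_ - _);
  apply: eq_bigr => e _.
have [ve|ve] := boolP (v \in ends e); last first.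
  rewrite inE (negPf ve); case: eqP => // /towards_ends.
  by rewrite (negPf ve).
have [u uv eqe] := other_end ve.
rewrite (order_orientationE hI _ eqe) 1?eq_sym //.
by rewrite (edges_intoP _ uv eqe) ?inE ?ltnn.
Qed.

Lemma order_orientation_deg h :
  deg (divisor_of (order_orientation h)) = (#|E|)%:Z - (#|V|)%:Z.
Proof.
rewrite deg_divisor_of; congr (_%:Z - _); apply: eq_card => e.
by rewrite inE /oriented /= ffunE.
Qed.

(* Dhar's burning algorithm: an unwinnable divisor is equivalent to one that is
   dominated by the divisor of an acyclic full orientation. *)
Lemma unwinnable_addr_chip D : ~ winnable D -> deg D < (#|E|)%:Z - (#|V|)%:Z ->
  exists u, ~ winnable (D + chip u).
Proof.
move=> unwin ltD; apply: contrapT => nou.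
have win u : winnable (D + chip u) by apply: contrapT => ?; apply: nou;
  exists u.
have [/card_gt0P[q _] _] := connG.
have [w w0 wfire] := exists_firing_weight connG q.
pose P H := effective H /\ lin_equiv (D + chip q) H.
(* A chip at [q] could be removed, making [D] winnable. *)
have Pq H : P H -> H q = 0.
  move=> [H0 DH]; apply: contrapT => /eqP Hq; apply: unwin; exists (H - chip q).
    by apply: effective_subr_chip; rewrite // lt_def Hq H0.
  by rewrite -[D](addrK (chip q)); apply: lin_equivD2r.
have [H0 H0eff DH0] := win q.
(* The maximal [H] plays the part of a [q]-reduced divisor. *)
have [H PH Hmax] : exists2 H, P H & forall F, P F ->
  \sum_v w v * F v <= \sum_v w v * H v.
  apply: (@exists_max _ P _ (\sum_v w v * (deg D + 1)) H0) => // F [F0 DF].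
  apply: ler_sum => v _;
    rewrite ler_pM2l // -(deg_chip q) -degD (lin_equiv_deg DF).
  exact: effective_le_deg.
have [Heff DH] := PH.
(* The term [(v == q)%:R] makes [q] burn first, as [H q = 0]. If the fire stops, the unburnt set can
   fire and raise the weight. *)
have [X XT|h hI hB] := @exists_order V (fun X v =>
    H v - (v == q)%:R < (#|edges_into X v|)%:Z).
  apply: contrapT => stuck.
  have {}stuck v : v \notin X -> (#|edges_into X v|)%:Z <= H v - (v == q)%:R.
    by move=> vX; rewrite leNgt; apply/negP => Bv; apply: stuck; exists v.
  have qX : q \in X.
    by apply: contraT => /stuck; rewrite (Pq _ PH) eqxx.
  have /Hmax : P (H - laplace (indicator (~: X))).
    split=> [v|]; last first.
      by apply: lin_equiv_trans DH _; rewrite -laplaceN;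
        apply/lin_equiv_sym/lin_equiv_laplace.
    rewrite [leRHS]ffunE [X in _ + X]ffunE subr_ge0.
    have [vX|vX] := boolP (v \in X).
      by apply: le_trans (Heff v); apply: laplace_indicator_le0; rewrite inE vX.
    rewrite laplace_indicator //; apply: le_trans (stuck v vX) _.
    by rewrite gerBl ler0n.
  apply/negP; rewrite -ltNge.
  have : \sum_u w u * laplace (indicator (~: X)) u < 0.
    apply: wfire; last by rewrite inE qX.
    by rewrite -setCT (inj_eq (@setC_inj _)).
  suff -> : \sum_v w v * (H - laplace (indicator (~: X))) v =
      \sum_v w v * H v - \sum_v w v * laplace (indicator (~: X)) v.
    by rewrite ltrDl oppr_gt0.
  rewrite -sumrB; apply: eq_bigr => v _.
  by rewrite [(H - _) v]ffunE [(- laplace _) v]ffunE; ring.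
pose O := order_orientation h.
have leO v : (H - chip q) v <= divisor_of O v.
  by rewrite order_orientation_divisor // !ffunE -ltzD1 subrK; apply: hB.
(* The degree of [H - chip q] is that of [D], below that of a full orientation, so the domination is
   strict somewhere. *)
have [u ltO] : exists u, (H - chip q) u < divisor_of O u.
  apply: contrapT => noltO; move: ltD; rewrite -(order_orientation_deg h).
  rewrite -[D](addrK (chip q)) [deg (_ - _)]degD (lin_equiv_deg DH) -degD.
  apply/negP; rewrite -leNgt; apply: ler_sum => v _; rewrite leNgt.
  by apply/negP => lt; apply: noltO; exists v.
have V0 : (0 < #|V|)%N by apply/card_gt0P; exists q.
(* The divisor of [O] still dominates [H - chip q + chip u], which is equivalent to [D + chip u], so
   it would be winnable. *)
apply: (acyclic_unwinnable V0 (order_orientation_acyclic hI)).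
have -> : divisor_of O =
    (H - chip q + chip u) + (divisor_of O - (H - chip q) - chip u).
  by apply/ffunP=> v; rewrite !ffunE; ring.
apply: winnableD; last first.
  apply: effective_subr_chip;
    last by rewrite [ltRHS]ffunE [X in _ < _ + X]ffunE subr_gt0.
  by move=> v; rewrite [leRHS]ffunE [X in _ <= _ + X]ffunE subr_ge0.
apply: winnable_equiv (win u); apply: lin_equiv_sym.
by rewrite -{1}[D](addrK (chip q)); do 2! apply: lin_equivD2r.
Qed.

End Unspecial.

(** * Unfurling by pivots and cut reversals *)

Section Unfurling.
Variables (G : multigraph) (connG : connected G).
Local Notation V := (vertex G).
Local Notation E := (edge G).
Implicit Types (O : orientation G) (e f : E) (u v : V).

Lemma eq_origin O O' e : O e = O' e -> origin O e = origin O' e.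
Proof. by rewrite /origin => ->. Qed.

(** A negative value can only be -1: no edge points to [v]. *)
Definition sources O : {set V} := [set v | divisor_of O v < 0].

Lemma sources_eq0 O : sources O = set0 -> effective (divisor_of O).
Proof.
by move=> src v; rewrite leNgt; apply/negP => v0; have := in_set0 v;
  rewrite -src inE v0.
Qed.

(* [X] is closed under taking origins, and the edges inside it form an acyclic
   digraph, as witnessed by [h]. *)
Definition burnt O (X : {set V}) : Prop := exists h : V -> nat, forall e u v,
  O e = Some v -> origin O e = Some u -> v \in X -> u \in X /\ (h u < h v)%N.

(** For [v] outside [X], no edge leads from [v] into [X], as [X] contains the origins of its
    incoming edges; so [v] can come last. *)
Lemma burnt_setU1 O (X : {set V}) v : burnt O X ->
    (forall e u, O e = Some v -> origin O e = Some u -> u \in X) ->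
  burnt O (v |: X).
Proof.
move=> [h hP] inX; pose N := \max_u h u.
have hN u : (h u <= N)%N by apply: leq_bigmax.
have [vX|vX] := boolP (v \in X); first by exists h;
  rewrite (setUidPr _) ?sub1set.
exists (fun u => if u == v then N.+1 else h u) => e u x Oe Ou.
rewrite !inE; have [xv _|xv /= xX] := eqVneq x v.
  have uX : u \in X by apply: (inX e); rewrite // -xv.
  rewrite uX orbT ifN; first by split; rewrite ?ltnS.
  by apply: contraNneq vX => <-.
have [uX hux] := hP e u x Oe Ou xX; rewrite uX orbT ifN //.
by apply: contraNneq vX => <-.
Qed.

Definition leaving O (X : {set V}) : {set E} := [set e |
  oapp (mem X) false (origin O e) && oapp (fun v => v \notin X) false (O e)].

Lemma leavingP O (X : {set V}) e u v : O e = Some v -> origin O e = Some u ->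
  (e \in leaving O X) = (u \in X) && (v \notin X).
Proof. by move=> Oe Ou; rewrite inE Oe Ou. Qed.

(* Burning from the sources, with edge pivots making as many edges as possible
   leave the burnt set. *)
Lemma exists_burnt O : exists O' (X : {set V}),
  [/\ O' \in class_of O, divisor_of O' = divisor_of O, burnt O' X,
    forall v, v \notin X -> exists e u,
      [/\ O' e = Some v, origin O' e = Some u & u \notin X] &
    forall e x y, ends e = [set x; y] ->
      x \in X -> y \notin X -> O' e = Some y].
Proof.
pose P (T : orientation G * {set V}) :=
  [/\ T.1 \in class_of O, divisor_of T.1 = divisor_of O & burnt T.1 T.2].
(* A lexicographic order: one more burnt vertex outweighs any loss of leaving edges. *)
pose pot (T : orientation G * {set V}) :=
  (#|T.2| * #|E|.+1 + #|leaving T.1 T.2|)%N.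
have P0 : P (O, set0).
  by split; rewrite ?class_of_refl //; exists (fun=> 0%N) => e u v _ _;
    rewrite inE.
have [[O' X] /= [/= O'O DO' bX] maxX] :=
  @exists_max_fin _ P (fun T => (pot T)%:Z) _ P0.
(* Otherwise [v] could be burnt too, raising the potential. *)
have inc v : v \notin X -> exists e u,
    [/\ O' e = Some v, origin O' e = Some u & u \notin X].
  move=> vX; apply: contrapT => noe.
  have /maxX : P (O', v |: X).
    split=> //; apply: burnt_setU1 => // e u Oe Ou; apply: contrapT => /negP uX.
    by apply: noe; exists e, u.
  rewrite lez_nat /pot /= cardsU1 vX add1n mulSn => le1.
  have le2 : (#|leaving O' X| <= #|E|)%N := max_card _.
  move: le1; apply/negP; rewrite -ltnNge -addnA addnCA ltn_add2l addSn ltnS.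
  exact: leq_trans le2 (leq_addr _ _).
exists O', X; split=> // e x y eqe xX yX.
have xy : x != y by apply: contraNneq yX => <-.
have [h hP] := bX.
case Oe: (O' e) => [z|].
  have [u [uz eqz Ou]] := originP Oe.
  have := towards_ends Oe; rewrite eqe !inE => /orP[] /eqP zE;
    last by rewrite zE.
  rewrite {}zE in Oe eqz uz *; have [uX _] := hP e u x Oe Ou xX.
  have := set22 x y; rewrite -eqe eqz !inE eq_sym (negPf xy) => /eqP yu.
  by rewrite yu uX in yX.
(* Here [e] is unoriented. Pivoting [g], which comes from outside [X], onto [e] gains a leaving edge
   and loses none. *)
have [g [u [Og Ou uX]]] := inc y yX.
have ye : y \in ends e by rewrite eqe !inE eqxx orbT.
have [O4 [O4O' DO4 O4g O4e O4f]] := exists_pivot Og Oe ye.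
have /maxX : P (O4, X).
  split; rewrite /= ?DO4 //; first exact: class_of_trans O4O'.
  exists h => f a b O4b; have fg : f != g.
    by apply/eqP=> fg; rewrite fg O4g in O4b.
  have [fe|fe] := eqVneq f e.
    by move: O4b; rewrite fe O4e => -[<-] _; rewrite (negPf yX).
  by have eqf := O4f f fg fe; rewrite eqf in O4b; rewrite (eq_origin eqf);
    apply: hP.
rewrite lez_nat /pot /= leq_add2l leqNgt => /negP[].
apply: proper_card; apply/properP; split.
  apply/subsetP=> f; have [->|fg] := eqVneq f g;
    first by rewrite (leavingP _ Og Ou) (negPf uX).
  have [->|fe] := eqVneq f e; first by rewrite inE Oe andbF.
  by have eqf := O4f f fg fe; rewrite !inE eqf (eq_origin eqf).
exists e; last by rewrite inE Oe andbF.
have [a [ay eqa Oa]] := originP O4e; rewrite (leavingP _ O4e Oa) yX andbT.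
have := set21 x y; rewrite -eqe eqa !inE (negPf xy) => /eqP <-.
exact: xX.
Qed.

(** Take the fewest sources in the class, then the largest firing weight about a source [q]. If
    everything burns, the orientation is acyclic. Otherwise all cut edges point to the unburnt set;
    reversing them fires this set, which avoids [q], and raises the weight without new sources. *)
Lemma unfurl O : exists2 O', O' \in class_of O &
  effective (divisor_of O') \/ acyclic O'.
Proof.
apply: contrapT => no.
have [O1 O1O min1] := @exists_max_fin _ (fun O' => O' \in class_of O)
  (fun O' => - (#|sources O'|)%:Z) _ (class_of_refl O).
have [q qO1] : exists q, q \in sources O1.
  apply/set0Pn/eqP => src; apply: no; exists O1 => //.
  by left; apply: sources_eq0.
have [w w0 wfire] := exists_firing_weight connG q.
have [O2 [O2O src2] max2] := @exists_max_fin _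
  (fun O' => O' \in class_of O /\ sources O' = sources O1)
  (fun O' => \sum_v w v * divisor_of O' v) _ (conj O1O erefl).
have [O3 [X [O3O2 D3 [h hP] inX outX]]] := exists_burnt O2.
have O3O := class_of_trans O2O O3O2.
have src3 : sources O3 = sources O1 by rewrite -src2 /sources D3.
have qX : q \in X.
  apply: contraT => /inX[e [u [Oe _ _]]]; move: qO1;
    rewrite -src3 inE ltNge divisor_of_ge0.
  by case/negP; apply/existsP; exists e; rewrite Oe.
have XT : X != setT.
  apply/eqP=> XT; apply: no; exists O3 => //; right.
  by apply: (acyclic_of_rank (h := h)) => e u v Oe Ou; case: (hP e u v Oe Ou);
    rewrite ?XT.
pose Y := ~: X; pose O4 := reverse O3 (cut Y).
have headsY e : e \in cut Y -> exists2 v, O3 e = Some v & v \in Y.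
  have [x [y [xy eqe]]] : exists x y, x != y /\ ends e = [set x; y].
    by exists (end1 e), (end2 e); rewrite end12 -endsE.
  rewrite (cut_cross _ xy eqe) !inE.
  case: (boolP (x \in X)) => xX; case: (boolP (y \in X)) => yX //= _.
    by exists y; rewrite ?inE //; apply: outX eqe xX yX.
  by exists x; rewrite ?inE //; apply: (outX e y x); rewrite // setUC.
have D4 := divisor_of_cut headsY.
have Y0 : Y != set0 by rewrite -setCT (inj_eq (@setC_inj _)).
have qY : q \notin Y by rewrite inE qX.
have O4O : O4 \in class_of O.
  apply: class_of_trans O3O _; rewrite inE connect1 //; apply/asboolP;
    apply: Or32.
  by exists Y; split=> //; apply: contraNneq qY => ->.
(* Edges into a burnt vertex start in [X], and each unburnt vertex has an edge from outside [X];
   such edges are not in the cut. *)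
have src4 : sources O4 \subset sources O1.
  rewrite -src3; apply/subsetP=> v; rewrite !inE; apply: contraTT;
    rewrite -!leNgt.
  rewrite !divisor_of_ge0 => /existsP[e0 /eqP Oe0].
  suff [e [u [Oe Ou same]]] : exists e u,
      [/\ O3 e = Some v, origin O3 e = Some u & (u \in X) = (v \in X)].
    apply/existsP; exists e; rewrite /O4 /= ffunE.
    have [uv eqe] := origin_ends Oe Ou; rewrite eq_sym in uv.
    by rewrite (cut_cross _ uv eqe) !inE same addbb Oe.
  have [vX|vX] := boolP (v \in X).
    have [u [_ _ Ou]] := originP Oe0; have [uX _] := hP _ _ _ Oe0 Ou vX.
    by exists e0, u.
  by have [e [u [Oe Ou /negPf uX]]] := inX v vX; exists e, u.
have {}src4 : sources O4 = sources O1.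
  by apply/eqP; rewrite eqEcard src4 -lez_nat -lerN2 min1.
have := max2 O4 (conj O4O src4); apply/negP; rewrite -ltNge -D3.
have -> : \sum_v w v * divisor_of O4 v =
    \sum_v w v * divisor_of O3 v - \sum_v w v * laplace (indicator Y) v.
  rewrite -sumrB; apply: eq_bigr => v _.
  by rewrite D4 [(divisor_of O3 - _) v]ffunE [(- laplace _) v]ffunE; ring.
by rewrite ltrDl oppr_gt0 wfire.
Qed.

Definition reachable O u : {set V} := [set v | connect (arrow O) u v].

Lemma reachable_arrow O u x y :
  x \in reachable O u -> arrow O x y -> y \in reachable O u.
Proof. by rewrite !inE => ux xy; apply: connect_trans ux (connect1 xy). Qed.

Lemma reachable_sub O O' u :
    (forall x y, x \in reachable O u -> arrow O x y -> arrow O' x y) ->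
  reachable O u \subset reachable O' u.
Proof.
move=> sub; apply/subsetP=> z; rewrite !inE => /connectP[p pathp ->].
suff gen x : path (arrow O) x p -> connect (arrow O') u x ->
  x \in reachable O u ->
    connect (arrow O') u (last x p).
  by apply: gen; rewrite ?inE ?connect0.
elim: p x {pathp} => //= y p IHp x /andP[xy pathp] ux xR.
apply: IHp => //; last exact: reachable_arrow xy.
by apply: connect_trans ux _; apply: connect1; apply: sub.
Qed.

(* The set reachable from [u] grows by pivoting an unoriented edge of its cut
   or, if there is none, by reversing the cut. *)
Lemma exists_all_reachable O u : effective (divisor_of O) ->
  exists2 O', O' \in class_of O & forall v, connect (arrow O') u v.
Proof.
move=> effO.
(* Effectiveness is weakened to unreachable vertices, since a cut reversal may turn reachable ones
   into sources. *)
pose P O' := O' \in class_of O /\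
  forall v, v \notin reachable O' u -> exists e, O' e = Some v.
have P0 : P O.
  by split=> [|v _]; [apply: class_of_refl|apply/effective_divisor_of: v].
have [O1 [O1O src1] max1] :=
  @exists_max_fin _ P (fun O' => (#|reachable O' u|)%:Z) _ P0.
exists O1 => // v1; apply: contrapT => /negP v1R.
set R := reachable O1 u in src1.
(* Maximality forbids an equivalent orientation that keeps the arrows inside [R] and an edge into
   each outside vertex, and has an arrow out of [R]. *)
have grow O' x y : O' \in class_of O1 ->
    (forall a b, a \in R -> b \in R -> arrow O1 a b -> arrow O' a b) ->
    (forall v, v \notin R -> exists e, O' e = Some v) ->
    x \in R -> y \notin R -> arrow O' x y -> False.
  move=> O'O1 sub src xR yR xy.
  have RR' : R \subset reachable O' u.
    by apply: reachable_sub => a b aR ab; apply: sub => //;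
      apply: reachable_arrow ab.
  have /max1 : P O'.
    split=> [|v vR']; first exact: class_of_trans O'O1.
    by apply: src; apply: contraNN vR' => /(subsetP RR').
  rewrite lez_nat leqNgt => /negP[]; apply: proper_card; apply/properP;
    split=> //.
  by exists y => //; apply: reachable_arrow xy; apply: (subsetP RR').
have inR e x y : ends e = [set x; y] -> x \in R -> y \notin R -> O1 e = Some x.
  move=> eqe xR yR; have xy : x != y by apply: contraNneq yR => <-.
  case Oe: (O1 e) => [z|].
    have := towards_ends Oe; rewrite eqe !inE => /orP[] /eqP zE;
      first by rewrite zE.
    rewrite {}zE in Oe; have [w [wy eqw Ow]] := originP Oe.
    have := set21 x y; rewrite -eqe eqw !inE (negPf xy) => /eqP xw.
    case/negP: yR; apply: (reachable_arrow xR).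
    by apply/arrowP; exists e; rewrite ?xw.
  (* Here [e] is unoriented; pivoting [g] onto it gives an arrow from [x] to [y]. *)
  have [g Og] := src1 y yR.
  have ye : y \in ends e by rewrite eqe !inE eqxx orbT.
  have [O' [O'O1 _ O'g O'e O'f]] := exists_pivot Og Oe ye.
  case: (grow O' x y) => // [a b aR bR /arrowP[f Oa Ob]|v vR|].
  - have fg : f != g by apply: contraNneq yR => fg; move: Ob;
    rewrite fg Og => -[->].
    have fe : f != e by apply/eqP => fe; rewrite fe Oe in Ob.
    have eqf := O'f f fg fe.
    by apply/arrowP; exists f; rewrite ?eqf ?(eq_origin eqf).
  - have [->|vy] := eqVneq v y; first by exists e.
    have [f Of] := src1 v vR; exists f.
    rewrite O'f //; first by apply: contraNneq vy => fg; move: Of;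
      rewrite fg Og => -[->].
    by apply/eqP=> fe; rewrite fe Oe in Of.
  - have [a [ay eqa Oa]] := originP O'e; apply/arrowP; exists e => //.
    by have := set21 x y; rewrite -eqe eqa !inE (negPf xy) => /eqP ->.
have headsR e : e \in cut R -> exists2 v, O1 e = Some v & v \in R.
  have [x [y [xy eqe]]] : exists x y, x != y /\ ends e = [set x; y].
    by exists (end1 e), (end2 e); rewrite end12 -endsE.
  rewrite (cut_cross _ xy eqe).
  case: (boolP (x \in R)) => xR; case: (boolP (y \in R)) => yR //= _.
    by exists x => //; apply: inR eqe xR yR.
  by exists y => //; apply: (inR e y x); rewrite // setUC.
have R0 : R != set0 by apply/set0Pn; exists u; rewrite inE connect0.
have RT : R != setT.
  by apply: contraNneq v1R => RT; have := in_setT v1; rewrite -RT inE.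
(* Connectivity gives a cut edge; it points into [R], so reversing the cut makes it an arrow out of
   [R]. *)
have [e [x [y [eqe xR yR]]]] := crossing_edge connG R0 RT.
have xy : x != y by apply: contraNneq yR => <-.
have Oe := inR e x y eqe xR yR.
have ecut : e \in cut R by rewrite (cut_cross _ xy eqe) xR (negPf yR).
have Oy : origin O1 e = Some y.
  have [w [wx eqw ->]] := originP Oe.
  by have := set22 x y; rewrite -eqe eqw !inE eq_sym (negPf xy) => /eqP ->.
apply: (grow (reverse O1 (cut R)) x y) =>
  // [|a b aR bR /arrowP[f Oa Ob]|v vR|].
- rewrite inE connect1 //; apply/asboolP; apply: Or32; by exists R.
- have [ab eqf] := origin_ends Ob Oa; rewrite eq_sym in ab.
  have rf : reverse O1 (cut R) f = O1 f.
    by rewrite /= ffunE (cut_cross _ ab eqf) aR bR.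
  by apply/arrowP; exists f; rewrite ?rf ?(eq_origin rf).
- have [f Of] := src1 v vR; exists f; rewrite /= ffunE ifN //.
  by apply/negP => /headsR[z Oz zR]; move: zR;
    rewrite -[z]/(odflt z (Some z)) -Oz Of /= (negPf vR).
- have rO : reverse O1 (cut R) e = Some y by rewrite /= ffunE ecut.
  have [w [wy eqw Ow]] := originP rO; apply/arrowP; exists e => //.
  by have := set21 x y; rewrite -eqe eqw !inE (negPf xy) => /eqP ->.
Qed.

End Unfurling.

(** * Numbers of path reversals against degrees of subtracted divisors *)

Section Distance.
Variables (G : multigraph) (connG : connected G).
Implicit Types (O : orientation G) (F : divisor G).

Lemma class_of_vertices O k :
  deg (divisor_of O) = k -> class_of O \in class_vertices G k.
Proof. by move=> degO; apply: imset_f; rewrite inE degO. Qed.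

Lemma acyclic_class_of_unwinnable k O : deg (divisor_of O) = k ->
  ~ winnable (divisor_of O) -> class_of O \in acyclic_classes G k.
Proof.
move=> degO nwin; rewrite inE class_of_vertices //=; apply/asboolP.
have [O' O'O [eff|acy]] := unfurl connG O; last by exists O'.
case: nwin; exists (divisor_of O') => //.
exact/lin_equiv_sym/class_lin_equiv.
Qed.

Lemma path_of_unwinnable k n O F : deg (divisor_of O) = k -> effective F ->
    deg F = n%:Z -> ~ winnable (divisor_of O - F) ->
  exists s, [/\ path (@class_adjacent G k) (class_of O) s,
    last (class_of O) s \in acyclic_classes G k & (size s <= n)%N].
Proof.
elim/ltn_ind: n O F => n IHn O F degO F0 degF unwin.
have [win|nwin] := pselect (winnable (divisor_of O)); last first.
  by exists [::]; split=> //; apply: acyclic_class_of_unwinnable.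
have [v Fv] : exists v, 0 < F v.
  apply: contrapT => noF; apply: unwin; suff -> : F = 0 by rewrite subr0.
  apply/ffunP=> v; rewrite ffunE; apply: contrapT => /eqP Fv; apply: noF.
  by exists v; rewrite lt_def Fv F0.
case: n IHn degF => [|n] IHn degF.
  by have := effective_le_deg v F0; rewrite degF leNgt Fv.
have {}IHn := IHn n (ltnSn n).
have F'0 := effective_subr_chip F0 Fv.
have degF' : deg (F - chip v) = n%:Z.
  by rewrite degD degN degF deg_chip; lia.
(* Here [deg F] is at least 1, which keeps the degree of [divisor_of O - F] below [#|E| - #|V|]. *)
have [u nwin] : exists u, ~ winnable (divisor_of O - F + chip u).
  apply: unwinnable_addr_chip => //; rewrite degD degN degF.
  by have := deg_divisor_of_le O; lia.
have [uv|uv] := eqVneq u v.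
  have [|s [ps ls szs]] := IHn O (F - chip v) degO F'0 degF'.
    by rewrite opprB addrA addrAC -uv.
  by exists s; split=> //; apply: ltnW.
have V0 : (0 < #|vertex G|)%N by have [] := connG.
have [O0 O0O [eff0|acy0]] := unfurl connG O; last first.
  case: (acyclic_unwinnable V0 acy0); apply: winnable_equiv win.
  exact: class_lin_equiv.
have [O1 O1O0 /(_ v) uv1] := exists_all_reachable connG u eff0.
have O1O := class_of_trans O0O O1O0.
have [p [dp D2]] := connect_directed_path uv uv1.
set O2 := reverse _ _ in D2.
have degO2 : deg (divisor_of O2) = k.
  rewrite D2 !degD degN !deg_chip addrK -degO; apply: lin_equiv_deg.
  exact: class_lin_equiv.
have [|s [ps ls szs]] := IHn O2 (F - chip v) degO2 F'0 degF'.
  move=> win2; apply: nwin; apply: winnable_equiv win2.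
  have -> : divisor_of O2 - (F - chip v) = divisor_of O1 - F + chip u.
    by rewrite D2; apply/ffunP=> z; rewrite !ffunE; ring.
  by do 2 apply: lin_equivD2r; apply/lin_equiv_sym/class_lin_equiv.
exists (class_of O2 :: s); split=> //; rewrite /= ps andbT.
apply/and3P; split; [exact: class_of_vertices|exact: class_of_vertices|].
apply/asboolP; exists O1, O2; split=> //; first exact: class_of_refl.
by exists p.
Qed.

(** Undoing the reversal of a path from [u] to [v] adds [chip v] to [F]: the later divisor minus [F]
    is equivalent to [divisor_of O - (F + chip v) + chip u], and adding [chip u] preserves
    winnability. *)
Lemma unwinnable_of_path k s O : path (@class_adjacent G k) (class_of O) s ->
    last (class_of O) s \in acyclic_classes G k ->
  exists F,
    [/\ effective F, deg F = (size s)%:Z & ~ winnable (divisor_of O - F)].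
Proof.
elim: s O => [|C s IHs] O /=.
  move=> _; rewrite inE => /andP[_ /asboolP[O' O'O acy]].
  exists 0; split=> [v||]; first by rewrite ffunE.
    by rewrite /deg big1 // => v _; rewrite ffunE.
  rewrite subr0 => win; have [V0 _] := connG;
    apply: (acyclic_unwinnable V0 acy).
  by apply: winnable_equiv win; apply: class_lin_equiv.
case/andP=> /and3P[_ /imsetP[O' _ ->] /asboolP[O1 [O2 [O1O O2O' [p dp rp]]]]].
move=> /IHs IH /IH[F [F0 degF unwin]].
have [u [v D2]] := divisor_of_path dp; rewrite -rp in D2.
exists (F + chip v); split.
- by apply: effectiveD => //; apply: effective_chip.
- by rewrite degD degF deg_chip; lia.
move=> win; apply: unwin.
apply: (@winnable_equiv _ _ (divisor_of O - (F + chip v) + chip u)); last first.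
  by apply: winnableD => //; apply: effective_chip.
apply: lin_equiv_trans (lin_equivD2r (- F) (lin_equiv_sym (class_lin_equiv
  O2O'))) _.
have -> : divisor_of O2 - F = divisor_of O1 - (F + chip v) + chip u.
  by rewrite D2; apply/ffunP=> z; rewrite !ffunE; ring.
by do 2 apply: lin_equivD2r; apply: class_lin_equiv.
Qed.

Lemma exists_effective_deg n :
  exists2 F : divisor G, effective F & deg F = n%:Z.
Proof.
have [/card_gt0P[q _] _] := connG; elim: n => [|n [F F0 degF]].
  exists 0 => [v|]; first by rewrite ffunE.
  by rewrite /deg big1 // => v _; rewrite ffunE.
exists (F + chip q); first by apply: effectiveD => //; apply: effective_chip.
by rewrite degD degF deg_chip; lia.
Qed.

End Distance.

Theorem theorem1p4 (G : multigraph) (connG : connected G)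
    (O : orientation G) (k : int) (degO : deg (divisor_of O) = k) :
  exists d : nat,
    is_distance (@class_adjacent G k) (class_of O) (acyclic_classes G k) d /\
    is_rank (divisor_of O) (d%:Z - 1).
Proof.
pose P n := exists s, [/\ path (@class_adjacent G k) (class_of O) s,
  last (class_of O) s \in acyclic_classes G k & size s = n].
have exP : exists n, `[< P n >].
  (* Subtracting degree [|k| + 1] leaves a negative degree, hence an unwinnable divisor, so some
     acyclic class is reachable. *)
  have [F F0 degF] := exists_effective_deg connG (`|k|.+1)%N.
  have [|s [ps ls _]] := path_of_unwinnable connG degO F0 degF.
    by move=> /winnable_deg; rewrite degD degN degO degF; lia.
  by exists (size s); apply/asboolP; exists s.
case: (ex_minnP exP) => d /asboolP Pd dmin.
exists d; split; first by split=> // n Pn; rewrite leEnat dmin //;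
  apply/asboolP.
have [s [ps ls szs]] := Pd.
(* A shortest path yields an [F] of degree [d]; any other admissible [F] yields a path of length at
   most [deg F], hence [d <= deg F]. *)
split=> [|n [F [F0 unwin ->]]].
  have [F [F0 degF unwin]] := unwinnable_of_path connG ps ls.
  by exists F; split=> //; rewrite degF szs.
have degF : deg F = (`|deg F|%N)%:Z by rewrite gez0_abs // sumr_ge0.
have [t [pt lt szt]] := path_of_unwinnable connG degO F0 degF unwin.
rewrite lerD2r degF lez_nat; apply: leq_trans szt; apply: dmin.
by apply/asboolP; exists t.
Qed.
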